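(* Let $K\subset\mathbb{R}^m$ be a pointed, closed, convex cone with nonempty interior which is finitely generated, let $C\subset\mathbb{R}^m$ be a finite set with $0\notin C$ and $K^*=\operatorname{cone}(\operatorname{conv}(C))$, and let $F:\mathbb{R}^n\to\mathbb{R}^m$ be continuously differentiable. Define $h(x,d)=\max\{\langle JF(x)d,w\rangle : w\in C\}$ and $v(x)=\arg\min_{d}\{h(x,d)+\tfrac12\|d\|^2\}$. Fix $0<\rho<1$, $0<\delta<1$, $\mu>2$, and $e\in\operatorname{int}(K)$ with $\langle w,e\rangle\le1$ for all $w\in C$. Let $x^0\in\mathbb{R}^n$ and assume: (A1) there is an open set $\Lambda$ containing $\mathcal{L}=\{x: F(x)\preceq_K F(x^0)\}$ such that $\|JF(x)-JF(y)\|\le L\|x-y\|$ for all $x,y\in\Lambda$; (A2) every sequence $\{D_k\}\subset F(\mathcal{L})$ with $D_{k+1}\preceq_K D_k$ for all $k$ admits $D\in\mathbb{R}^m$ with $D\preceq_K D_k$ for all $k$. Let $\{x^k\}$ be an infinite sequence generated as follows: $d^0=v(x^0)$; for $k\ge1$, $d^k=v(x^k)+\beta_k d^{k-1}$ with $$\beta_k=\frac{-h(x^k,v(x^k))\big(|h(x^{k-1},v(x^k))|+h(x^{k-1},v(x^k))\big)}{\max\big\{\mu|h(x^k,d^{k-1})h(x^{k-1},v(x^k))|,\ -\mu h(x^{k-1},v(x^{k-1}))|h(x^{k-1},v(x^k))|\big\}};$$ $x^{k+1}=x^k+\alpha_kd^k$, where, with $\tau_k=-h(x^k,d^k)/\|d^k\|^2$,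 $\alpha_k$ is the largest element of $\{\tau_k,\delta\tau_k,\delta^2\tau_k,\dots\}$ satisfying the Armijo condition $$F(x^k+\alpha_kd^k)\preceq_K F(x^k)+\rho\alpha_k h(x^k,d^k)e.$$ Then $\liminf_{k\to\infty}\|v(x^k)\|=0$.
   Context: $u\preceq_K v$ means $v-u\in K$. $K^*$ is the positive polar cone of $K$ and $JF$ the Jacobian of $F$. The sequence is assumed infinite, i.e. $v(x^k)\neq0$ for all $k$; $v(x)=0$ iff $x$ is a $K$-Pareto critical point, i.e. $\operatorname{Im}(JF(x))\cap(-\operatorname{int}K)=\emptyset$. *)

(* Defs.v *)
From HB Require Import structures.
From mathcomp Require Import all_boot all_order all_algebra.
From mathcomp Require Import all_classical all_reals all_analysis.
Set Implicit Arguments. Unset Strict Implicit. Unset Printing Implicit Defensive.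
Import Order.TTheory GRing.Theory Num.Theory.
Import numFieldNormedType.Exports.
Local Open Scope classical_set_scope.
Local Open Scope ring_scope.

Section Defs.
Variable R : realType.

Definition dotv (k : nat) (u w : 'cV[R]_k) : R := \sum_(i < k) u i 0 * w i 0.
Definition enorm (k : nat) (u : 'cV[R]_k) : R := Num.sqrt (dotv u u).

Definition coneLe (k : nat) (K : set 'cV[R]_k) (u v : 'cV[R]_k) : Prop :=
  K (v - u).

Definition is_cone (k : nat) (K : set 'cV[R]_k) : Prop :=
  K 0 /\ forall (t : R) x, 0 <= t -> K x -> K (t *: x).
Definition is_convex (k : nat) (K : set 'cV[R]_k) : Prop :=
  forall (t : R) x y, 0 <= t <= 1 -> K x -> K y -> K (t *: x + (1 - t) *: y).
Definition is_pointed (k : nat) (K : set 'cV[R]_k) : Prop :=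
  forall x, K x -> K (- x) -> x = 0.
Definition cone_gen (k : nat) (G : seq 'cV[R]_k) : set 'cV[R]_k :=
  [set x | exists lam : nat -> R, (forall i, 0 <= lam i) /\
             x = \sum_(i < size G) lam i *: G`_i].
Definition finitely_generated (k : nat) (K : set 'cV[R]_k) : Prop :=
  exists G : seq 'cV[R]_k, K = cone_gen G.

Definition polar (k : nat) (K : set 'cV[R]_k) : set 'cV[R]_k :=
  [set w | forall x, K x -> 0 <= dotv w x].
Definition conv_hull (k : nat) (C : seq 'cV[R]_k) : set 'cV[R]_k :=
  [set x | exists lam : nat -> R, (forall i, 0 <= lam i) /\
             \sum_(i < size C) lam i = 1 /\
             x = \sum_(i < size C) lam i *: C`_i].
Definition cone_of (k : nat) (S : set 'cV[R]_k) : set 'cV[R]_k :=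
  [set x | exists t : R, exists s, 0 <= t /\ S s /\ x = t *: s].

(* maximum of f over a finite nonempty list (value for the empty list is
   irrelevant: K^* = cone(conv C) forces C to be nonempty) *)
Definition seqmax (T : Type) (f : T -> R) (s : seq T) : R :=
  match s with
  | [::] => 0
  | c :: s' => foldr (fun w acc => Num.max (f w) acc) (f c) s'
  end.

Definition hfun (n m : nat) (JF : 'cV[R]_n -> 'M[R]_(m, n))
  (C : seq 'cV[R]_m) (x d : 'cV[R]_n) : R :=
  seqmax (fun w => dotv (JF x *m d) w) C.

(* v(x) = argmin_d { h(x,d) + 1/2 ||d||^2 } (the minimizer is unique) *)
Definition vfun (n m : nat) (JF : 'cV[R]_n -> 'M[R]_(m, n))
  (C : seq 'cV[R]_m) (x : 'cV[R]_n) : 'cV[R]_n :=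
  xget 0 [set d | forall d', hfun JF C x d + 2^-1 * enorm d ^+ 2
                             <= hfun JF C x d' + 2^-1 * enorm d' ^+ 2].

End Defs.

(* Main.v *)
Require Import Defs.
From HB Require Import structures.
From mathcomp Require Import all_boot all_order all_algebra.
From mathcomp Require Import all_classical all_reals all_analysis.
From mathcomp Require Import ring lra.
Set Implicit Arguments.
Unset Strict Implicit.
Unset Printing Implicit Defensive.
Import Order.TTheory GRing.Theory Num.Theory.
Import numFieldNormedType.Exports.
Local Open Scope classical_set_scope.
Local Open Scope ring_scope.

(** Write [N k = |v (x k)|] and [q = 2 / mu < 1].  Minimality of [v] along its own ray
gives [h x (v x) = - |v x|^2], and the formula for [beta] then yields
[h (x k) (d k) <= - (1 - q) N k ^ 2] and [|d k| <= N k + q (N k / N (k-1))^2 |d (k-1)|].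
Every small enough multiple of [tau] satisfies the Armijo condition, so [alpha k >= omega * tau k]
for a constant [omega > 0], and each [<F (x k), w>] with [w] in [C], which is bounded below by (A2),
drops by at least a constant times [(h (x k) (d k) / |d k|)^2] at every step.  If [N] stayed above
[gamma > 0], the ratio [|d k| / N k ^ 2] would satisfy [u k <= 1 / gamma + q u (k-1)], hence stay
bounded, and these drops would be bounded away from 0: a contradiction. *)

(** * Euclidean geometry of column vectors *)

Section InnerProduct.
Context {R : realType} {k : nat}.
Implicit Types (u v w : 'cV[R]_k) (a : R).

Lemma dotvC u w : dotv u w = dotv w u.
Proof. by apply: eq_bigr => i _; rewrite mulrC. Qed.

Lemma dotvDl u v w : dotv (u + v) w = dotv u w + dotv v w.
Proof. by rewrite -big_split; apply: eq_bigr => i _; rewrite mxE mulrDl. Qed.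

Lemma dotvZl a u w : dotv (a *: u) w = a * dotv u w.
Proof. by rewrite mulr_sumr; apply: eq_bigr => i _; rewrite mxE mulrA. Qed.

Lemma dotvNl u w : dotv (- u) w = - dotv u w.
Proof. by rewrite -scaleN1r dotvZl mulN1r. Qed.

Lemma dotvBl u v w : dotv (u - v) w = dotv u w - dotv v w.
Proof. by rewrite dotvDl dotvNl. Qed.

Lemma dotvDr w u v : dotv w (u + v) = dotv w u + dotv w v.
Proof. by rewrite !(dotvC w) dotvDl. Qed.

Lemma dotvZr a w u : dotv w (a *: u) = a * dotv w u.
Proof. by rewrite !(dotvC w) dotvZl. Qed.

Lemma dotvBr w u v : dotv w (u - v) = dotv w u - dotv w v.
Proof. by rewrite !(dotvC w) dotvBl. Qed.

Lemma dot0v w : dotv 0 w = 0.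
Proof. by rewrite -(scale0r 0) dotvZl mul0r. Qed.

Lemma dotv_suml (I : Type) (r : seq I) (f : I -> 'cV[R]_k) w :
  dotv (\sum_(i <- r) f i) w = \sum_(i <- r) dotv (f i) w.
Proof. by elim/big_ind2 : _ => [|_ u _ v <- <-|//]; rewrite ?dot0v ?dotvDl. Qed.

Lemma dotv_ge0 u : 0 <= dotv u u.
Proof. by apply: sumr_ge0 => i _; rewrite -expr2 sqr_ge0. Qed.

Lemma sqr_coord_le_dotv u i : u i 0 ^+ 2 <= dotv u u.
Proof.
rewrite /dotv (bigD1 i)//= expr2 lerDl.
by apply: sumr_ge0 => j _; rewrite -expr2 sqr_ge0.
Qed.

Lemma dotv_eq0 u : (dotv u u == 0) = (u == 0).
Proof.
apply/eqP/eqP => [u0|->]; last exact: dot0v.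
apply/colP => i; rewrite mxE; apply/eqP; rewrite -sqrf_eq0 eq_le sqr_ge0 andbT.
by rewrite -u0 sqr_coord_le_dotv.
Qed.

Lemma sqr_enorm u : enorm u ^+ 2 = dotv u u.
Proof. by rewrite sqr_sqrtr ?dotv_ge0. Qed.

Lemma enorm_ge0 u : 0 <= enorm u. Proof. exact: sqrtr_ge0. Qed.

Lemma enorm_gt0 u : u != 0 -> 0 < enorm u.
Proof. by move=> u0; rewrite sqrtr_gt0 lt_neqAle eq_sym dotv_eq0 u0 dotv_ge0. Qed.

Lemma enormZ a u : enorm (a *: u) = `|a| * enorm u.
Proof.
by rewrite /enorm dotvZl dotvZr mulrA -expr2 sqrtrM ?sqr_ge0// sqrtr_sqr.
Qed.

(** Cauchy-Schwarz: the squared norm of [W ^+ 2 *: u - dotv u w *: w] is [W ^+ 2] times the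
    difference of the squared sides. *)
Lemma dotv_le_enorm u w : dotv u w <= enorm u * enorm w.
Proof.
have [->|w0] := eqVneq w 0.
  by rewrite dotvC dot0v mulr_ge0 ?enorm_ge0.
have N0 := enorm_gt0 w0; set U := enorm u; set W := enorm w in N0 *.
have U0 : 0 <= U := enorm_ge0 u.
suff : 0 <= W ^+ 2 * ((U * W) ^+ 2 - dotv u w ^+ 2).
  rewrite pmulr_rge0 ?exprn_gt0// subr_ge0 => le2.
  have [//|lt] := leP (dotv u w) (U * W).
  have : (U * W) ^+ 2 < dotv u w ^+ 2 by rewrite ltr_pXn2r ?nnegrE//; nra.
  by rewrite ltNge le2.
have := dotv_ge0 (W ^+ 2 *: u - dotv u w *: w).
rewrite !(dotvBl, dotvBr, dotvZl, dotvZr) -!sqr_enorm (dotvC w u) -/U -/W.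
by move=> h; apply: le_trans h _; rewrite le_eqVlt; apply/orP; left; apply/eqP; ring.
Qed.

Lemma ler_enormD u w : enorm (u + w) <= enorm u + enorm w.
Proof.
rewrite -(@ler_pXn2r _ 2)// ?nnegrE ?addr_ge0 ?enorm_ge0//.
rewrite sqr_enorm !(dotvDl, dotvDr) (dotvC w u) -!sqr_enorm.
have := dotv_le_enorm u w; lra.
Qed.

(** The codomain [R^o] makes the pairing a linear map between normed modules, as the chain rule
    needs. *)
Definition dotvr w u : R^o := dotv u w.

Lemma dotvr_linear w : linear (dotvr w).
Proof. by move=> a u v; rewrite /dotvr dotvDl dotvZl. Qed.

HB.instance Definition _ w :=
  GRing.isLinear.Build R 'cV[R]_k R^o *:%R (dotvr w) (dotvr_linear w).

End InnerProduct.

(** * Continuity of pairings and of transposition *)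

Section Continuity.
Context {R : realType}.

Lemma continuous_sum (T : topologicalType) (I : Type) (r : seq I) (f : I -> T -> R) :
  (forall i, continuous (f i)) -> continuous (fun z => \sum_(i <- r) f i z).
Proof.
move=> fc z; elim: r => [|i r IH].
  rewrite (_ : (fun _ => _) = cst 0); first exact: cst_continuous.
  by apply/funext => y; rewrite big_nil.
rewrite (_ : (fun _ => _) = (f i \+ fun y => \sum_(i <- r) f i y)).
  by apply: continuousD => //; exact: fc.
by apply/funext => y; rewrite big_cons.
Qed.

Lemma continuous_dotv k (w : 'cV[R]_k) : continuous (fun u => dotv u w).
Proof.
apply: continuous_sum => i z.
by apply: continuousM; [exact: coord_continuous|exact: cst_continuous].
Qed.

Lemma continuous_dotvv k : continuous (fun u : 'cV[R]_k => dotv u u).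
Proof.
by apply: continuous_sum => i z; apply: continuousM; exact: coord_continuous.
Qed.

Lemma continuous_trmx m n : continuous (@trmx R m n).
Proof.
move=> A P /nbhs_ballP[e /= e0 AP]; apply/nbhs_ballP; exists e => // B [_ AB].
by apply: AP; split => // i j; rewrite !mxE; exact: AB.
Qed.

End Continuity.

(** * Projection, separation and the bipolar theorem *)

Section Bipolar.
Context {R : realType} {k : nat}.
Implicit Types (K : set 'cV[R]_k) (C : seq 'cV[R]_k).

(** Since 0 lies in [K], only points at distance at most [enorm y] from [y] matter; they form a
    compact set. Transposing to rows makes [rV_compact] and [EVT_min_rV] applicable. *)
Lemma closest_point K y : closed K -> K 0 ->
  exists2 p, K p & forall z, K z -> dotv (p - y) (p - y) <= dotv (z - y) (z - y).
Proof.
move=> Kcl K0.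
pose A := [set r : 'rV[R]_k | K r^T /\ dotv (r^T - y) (r^T - y) <= dotv y y].
pose f (r : 'rV[R]_k) := dotv (r^T - y) (r^T - y).
have fc : continuous f.
  move=> r; rewrite /f.
  apply: (@continuous_comp _ _ _ (fun r : 'rV[R]_k => r^T - y) (fun u => dotv u u)).
    by apply: continuousB; [exact: continuous_trmx|exact: cst_continuous].
  exact: continuous_dotvv.
have Acl : closed A.
  apply: closedI.
    by apply: (closed_comp (f := @trmx R 1 k)) => // z _; exact: continuous_trmx.
  by apply: (closed_comp (f := f) (D := [set t | t <= dotv y y])) => [z _|];
    [exact: fc|exact: closed_le].
have Aco : compact A.
  pose B := [set v : 'rV[R]_k |
    forall i, `[y i 0 - enorm y, y i 0 + enorm y]%classic (v ord0 i)].
  apply: (subclosed_compact Acl (B := B)).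
    apply: (@rV_compact _ _ (fun i => `[y i 0 - enorm y, y i 0 + enorm y]%classic)).
    by move=> i; exact: segment_compact.
  move=> r [_ ry] i; rewrite /= in_itv /=.
  have := le_trans (sqr_coord_le_dotv _ i) ry.
  rewrite -sqr_enorm => /ler_wsqrtr; rewrite !sqrtr_sqr (ger0_norm (enorm_ge0 _)).
  by rewrite !mxE ler_distlC => /andP[? ?]; apply/andP; split; lra.
have A0 : A !=set0 by exists 0; rewrite /A /= trmx0 sub0r dotvNl dotvC dotvNl opprK.
have [c /set_mem [Kc fcy] cmin] := EVT_min_rV A0 Aco (continuous_subspaceT fc).
exists c^T => // z Kz.
have [zy|yz] := leP (dotv (z - y) (z - y)) (dotv y y).
  have := cmin z^T; rewrite /f trmxK; apply.
  by apply/mem_set; rewrite /A /= trmxK.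
exact: le_trans fcy (ltW yz).
Qed.

Lemma convex_coneD K : is_cone K -> is_convex K ->
  forall u v, K u -> K v -> K (u + v).
Proof.
move=> [_ KZ] Kconv u v Ku Kv.
have -> : u + v = 2 *: (2^-1 *: u + (1 - 2^-1) *: v).
  rewrite scalerDr !scalerA (_ : 2 * 2^-1 = 1) ?divff//.
  by rewrite (_ : 2 * (1 - 2^-1) = 1) ?scale1r//; field.
by apply: KZ => //; apply: Kconv => //; lra.
Qed.

(** The separating vector is [p - y], where [p] is the point of [K] closest to [y]. *)
Lemma polar_separation K y : is_cone K -> is_convex K -> closed K -> ~ K y ->
  exists2 w, polar K w & dotv w y < 0.
Proof.
move=> Kcone Kconv Kcl Ky; have [K0 KZ] := Kcone.
have [p Kp pmin] := closest_point y Kcl K0.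
have [q qE] : exists q, q = p - y by exists (p - y).
rewrite -qE in pmin.
have q0 : 0 < dotv q q.
  rewrite lt_neqAle eq_sym dotv_eq0 dotv_ge0 andbT qE subr_eq0.
  by apply: contra_notN Ky => /eqP <-.
(* first-order optimality of [p] in a direction staying inside [K] *)
have opt v : (forall t, 0 <= t <= 1 -> K (p + t *: v)) -> 0 <= dotv q v.
  move=> Kv; rewrite leNgt; apply/negP => qv.
  have Q0 := dotv_ge0 v; set Q := dotv v v in Q0.
  set a := - dotv q v; have a0 : 0 < a by rewrite oppr_gt0.
  (* Since [|q + t v|^2 = |q|^2 - 2 t a + t^2 Q], a step in (0, 1] with [t Q <= a] would bring the
     point strictly closer to [y]. *)
  pose t := a / (a + Q).
  have aQ : 0 < a + Q by lra.
  have t0 : 0 < t by rewrite divr_gt0.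
  have tE : t * (a + Q) = a by rewrite divfK// gt_eqF.
  have t1 : t <= 1 by rewrite ler_pdivrMr//; lra.
  have /pmin : K (p + t *: v) by apply: Kv; rewrite (ltW t0).
  have -> : p + t *: v - y = q + t *: v by rewrite addrAC -qE.
  rewrite !(dotvDl, dotvDr, dotvZl, dotvZr) (dotvC v q) -/Q.
  have -> : dotv q v = - a by rewrite opprK.
  nra.
(* Shrinking [p] towards 0 stays in the cone, so [<q, p> <= 0]; hence
   [<q, y> = <q, p> - |q|^2 < 0]. *)
have qp : 0 <= dotv q (- p).
  apply: opt => t /andP[t0 t1]; rewrite scalerN -{1}(scale1r p) -scalerBl.
  by apply: KZ => //; lra.
have qz z : K z -> 0 <= dotv q z.
  move=> Kz; apply: opt => t /andP[t0 _].
  by apply: convex_coneD => //; exact: KZ.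
exists q => //.
have -> : y = p - q by rewrite qE opprB addrC subrK.
rewrite dotvBr -(opprK p) dotvC dotvNl (dotvC _ q); lra.
Qed.

(** Bipolar theorem: a point outside [K] is separated from it by a polar vector, which is a
    nonnegative combination of [C]. *)
Lemma generated_polarP K C : is_cone K -> is_convex K -> closed K ->
  polar K = cone_of (conv_hull C) ->
  forall y, K y <-> forall w, w \in C -> 0 <= dotv y w.
Proof.
move=> Kcone Kconv Kcl KC y; split => [Ky w wC|yC].
  suff : polar K w by move=> /(_ _ Ky); rewrite dotvC.
  rewrite KC; exists 1, w; split => //; split; last by rewrite scale1r.
  exists (fun i => (i == index w C)%:R); split; first by [].
  have iC : (index w C < size C)%N by rewrite index_mem.
  have off (i : 'I_(size C)) : i != Ordinal iC -> (i == index w C :> nat)%:R = 0 :> R.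
    by rewrite -val_eqE /= => /negPf ->.
  split; rewrite (bigD1 (Ordinal iC))//= eqxx big1 ?addr0//.
    by rewrite scale1r nth_index.
  by move=> i /off ->; rewrite scale0r.
apply: contrapT => nKy.
have [w] := polar_separation Kcone Kconv Kcl nKy.
rewrite KC => -[t [_ [t0 [[lam [lam0 [_ ->]]] ->]]]].
rewrite dotvZl dotv_suml ltNge mulr_ge0//; apply: sumr_ge0 => i _.
by rewrite dotvZl mulr_ge0// dotvC yC// mem_nth.
Qed.

(** The polar contains 0, so the hull is inhabited, and weights over an empty list cannot sum to
    1. *)
Lemma polar_generators_neq0 K C : polar K = cone_of (conv_hull C) -> C != [::].
Proof.
move=> KC; have : polar K 0 by move=> z _; rewrite dot0v.
rewrite KC => -[t [s [_ [[lam [_ [+ _]]] _]]]].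
by case: C {KC} => //=; rewrite big_ord0 => /eqP; rewrite eq_sym oner_eq0.
Qed.

(** For small [t > 0] the point [e - t *: w] is still in [K], so [<w, e> >= t |w|^2]. *)
Lemma interior_dotv_gt0 K e w : polar K w -> w != 0 -> K^° e -> 0 < dotv w e.
Proof.
move=> Kw w0 Ke.
have lc : {for 0, continuous (fun t : R => e - t *: w)}.
  apply: continuousB; first exact: cst_continuous.
  exact: scalel_continuous.
have : nbhs (e - (0 : R) *: w) K by rewrite scale0r subr0.
move=> /lc /nbhs_ballP[eps /= eps0 epsK].
have /epsK /Kw : ball (0 : R) eps (eps / 2).
  by rewrite /ball /= sub0r normrN gtr0_norm; lra.
rewrite dotvBr dotvZr -sqr_enorm subr_ge0; apply: lt_le_trans.
by rewrite mulr_gt0 ?exprn_gt0 ?enorm_gt0//; lra.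
Qed.

End Bipolar.

(** * Sublinearity of [h] and its value at the minimizer *)

Section SupportFunction.
Context {R : realType}.

Lemma seqmax_leP (T : eqType) (f : T -> R) s b : s != [::] ->
  reflect (forall w, w \in s -> f w <= b) (seqmax f s <= b).
Proof.
case: s => // c s _.
have -> : (seqmax f (c :: s) <= b) = all (fun w => f w <= b) (c :: s).
  rewrite /seqmax /=; elim: s => [|w s IH] /=; first by rewrite andbT.
  by rewrite ge_max IH; case: (f w <= b); rewrite ?andbF.
exact: allP.
Qed.

Context {n m : nat} (JF : 'cV[R]_n -> 'M[R]_(m, n)) (C : seq 'cV[R]_m).
Hypothesis C0 : C != [::].
Local Notation h := (hfun JF C).

Lemma dotv_le_hfun x d w : w \in C -> dotv (JF x *m d) w <= h x d.
Proof. by move=> wC; have /seqmax_leP := lexx (h x d); exact. Qed.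

Lemma hfunD_le x d d' : h x (d + d') <= h x d + h x d'.
Proof.
apply/seqmax_leP => // w wC; rewrite mulmxDr dotvDl.
by rewrite lerD// dotv_le_hfun.
Qed.

Lemma hfunZ_le x t d : 0 <= t -> h x (t *: d) <= t * h x d.
Proof.
move=> t0; apply/seqmax_leP => // w wC; rewrite -scalemxAr dotvZl.
by rewrite ler_wpM2l// dotv_le_hfun.
Qed.

Lemma hfun_vfun x : vfun JF C x != 0 ->
  h x (vfun JF C x) = - enorm (vfun JF C x) ^+ 2.
Proof.
move=> v0; have N0 : 0 < enorm (vfun JF C x) ^+ 2 by rewrite exprn_gt0 ?enorm_gt0.
(* [xget] returns 0 when there is no minimizer; [v0] excludes that case. *)
have vmin d : h x (vfun JF C x) + 2^-1 * enorm (vfun JF C x) ^+ 2 <=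
              h x d + 2^-1 * enorm d ^+ 2.
  by move: v0; rewrite {1}/vfun /(vfun _ _ _); case: xgetP => [v -> + _|]; rewrite ?eqxx.
set H := h x _ in vmin *; set N := enorm _ ^+ 2 in vmin N0 *.
have ineq t : 0 <= t -> H + 2^-1 * N <= t * H + 2^-1 * (t ^+ 2 * N).
  move=> t0; have := vmin (t *: vfun JF C x).
  rewrite enormZ exprMn real_normK ?num_real// => /le_trans; apply.
  by rewrite lerD2r hfunZ_le.
have H0 : H <= 0 by have := ineq 0 (lexx _); rewrite expr0n /=; lra.
(* This point minimizes the parabola [t * H + 2^-1 * (t ^+ 2 * N)]; comparison with its value at 1
   forces it to be 1. *)
have t0 : 0 <= - H / N by rewrite divr_ge0 ?oppr_ge0 ?(ltW N0).
have := ineq _ t0; clear t0.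
set t := - H / N; have -> : H = - (t * N) by rewrite divfK ?opprK ?gt_eqF.
move=> le_t; have : (t - 1) ^+ 2 * N <= 0 by lra.
rewrite pmulr_lle0// => t1; have /eqP : (t - 1) ^+ 2 = 0 by apply: le_anti; rewrite t1 sqr_ge0.
by rewrite sqrf_eq0 subr_eq0 => /eqP ->; rewrite mul1r.
Qed.

End SupportFunction.

(** * Real induction and mean value estimates along a line *)

Section LineSearch.
Context {R : realType}.

(** At the infimum of the counterexamples [P] holds by closedness, and the extension step then
    pushes [P] past that infimum. *)
Lemma real_induction (P : R -> Prop) (T : R) :
  P 0 -> closed [set t | P t] ->
  (forall t, 0 <= t < T -> (forall s, 0 <= s <= t -> P s) ->
     exists2 eps, 0 < eps & forall s, t < s < t + eps -> s <= T -> P s) ->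
  forall t, 0 <= t <= T -> P t.
Proof.
move=> P0 Pcl Pstep t0 /andP[t00 t0T]; apply: contrapT => nPt0.
pose S := [set s | 0 <= s <= T /\ ~ P s].
have S0 : S !=set0 by exists t0; split => //; rewrite t00.
have Slb : lbound S 0 by move=> s [/andP[]].
set s0 := inf S.
have s00 : 0 <= s0 by exact: lb_le_inf.
have s0t0 : s0 <= t0 by apply: ge_inf; [exists 0|split => //; rewrite t00].
have Plt s : 0 <= s -> s < s0 -> P s.
  move=> sge0 ss0; apply: contrapT => nPs.
  have : s0 <= s.
    apply: ge_inf; first by exists 0.
    by split => //; rewrite sge0 /=; lra.
  by rewrite leNgt ss0.
have Ps0 : P s0.
  apply: contrapT => nPs0.
  have s0_gt0 : 0 < s0.
    by rewrite lt_neqAle s00 andbT; apply: contra_notN nPs0 => /eqP <-.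
  have : nbhs s0 (~` [set t | P t]).
    by apply: open_nbhs_nbhs; split => //; exact: closed_openC.
  move=> /nbhs_ballP[eps /= eps0 epsP].
  pose s := Num.max 0 (s0 - eps / 2).
  have [sge0 s_ge] : 0 <= s /\ s0 - eps / 2 <= s by rewrite !le_max !lexx orbT.
  have ss0 : s < s0 by rewrite gt_max s0_gt0 /=; lra.
  by apply: (epsP s); [rewrite /ball /= ger0_norm; lra|exact: Plt].
have s0T : s0 < t0.
  by rewrite lt_neqAle s0t0 andbT; apply: contra_notN nPt0 => /eqP <-.
have [||eps eps0 epsP] := Pstep s0.
- by rewrite s00; lra.
- move=> s /andP[sge0]; rewrite le_eqVlt => /orP[/eqP -> //|]; exact: Plt.
have [s [/andP[sge0 sT] nPs] sltd] : exists2 s, S s & s < s0 + eps.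
  by apply: inf_adherent => //; split => //; exists 0.
apply: (nPs); apply: epsP => //; rewrite sltd andbT lt_neqAle.
apply/andP; split; first by apply: contra_notN nPs => /eqP <-.
by apply: ge_inf; [exists 0|split => //; rewrite sge0].
Qed.

Context {n m : nat} (F : 'cV[R]_n -> 'cV[R]_m) (JF : 'cV[R]_n -> 'M[R]_(m, n)).
Hypothesis dF : forall z, differentiable F z /\
  ('d F z : 'cV[R]_n -> 'cV[R]_m) = (fun u => JF z *m u).

Lemma is_derive_dotv_line (x d : 'cV[R]_n) w (t : R) :
  is_derive t (1 : R) (fun s : R => dotv (F (x + s *: d)) w : R)
    (dotv (JF (x + t *: d) *m d) w).
Proof.
pose l (s : R) := x + s *: d.
have [dFt dFE] := dF (l t).
have dl : is_diff t l (0 + *:%R^~ d) by apply: is_diffD.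
have dw y : is_diff y (dotvr w) (dotvr w).
  apply: DiffDef; first by apply: linear_differentiable; exact: continuous_dotv.
  by apply: diff_lin; exact: continuous_dotv.
have dFd : is_diff (l t) F (fun u => JF (l t) *m u) by apply: DiffDef.
have dg : is_diff t (dotvr w \o (F \o l)) (dotvr w \o ((fun u => JF (l t) *m u) \o (0 + *:%R^~ d))).
  exact: is_diff_comp.
have dgt : differentiable (dotvr w \o (F \o l)) t by [].
apply: DeriveDef; first exact: diff_derivable.
by rewrite (deriveE _ dgt) diff_val /= /dotvr fctE scale1r add0r.
Qed.

Lemma continuous_line (x d : 'cV[R]_n) : continuous (fun t : R => x + t *: d).
Proof.
move=> t; apply: (@continuousD R 'cV[R]_n R (cst x) ( *:%R^~ d) t).
  exact: cst_continuous.
exact: scalel_continuous.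
Qed.

Lemma continuous_F_line (x d : 'cV[R]_n) : continuous (fun t : R => F (x + t *: d)).
Proof.
move=> t; apply: (@continuous_comp _ _ _ (fun t : R => x + t *: d) F).
  exact: continuous_line.
by apply: differentiable_continuous; case: (dF (x + t *: d)).
Qed.

(** Mean value theorem for [<F, w>] restricted to the segment. *)
Lemma line_increment_le (x d : 'cV[R]_n) w (b a : R) : 0 <= a ->
  (forall s, 0 <= s <= a -> dotv (JF (x + s *: d) *m d) w <= b) ->
  dotv (F (x + a *: d)) w <= dotv (F x) w + a * b.
Proof.
rewrite le_eqVlt => /orP[/eqP <-|a0] Hb; first by rewrite scale0r addr0 mul0r addr0.
have [|c] := MVT a0 (fun t _ => is_derive_dotv_line x d w t).
  apply: continuous_subspaceT => t.
  apply: (@continuous_comp _ _ _ (fun t : R => F (x + t *: d)) (dotvr w)).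
    exact: continuous_F_line.
  exact: continuous_dotv.
rewrite in_itv /= => /andP[c0 ca] /eqP; rewrite subr0 scale0r addr0 subr_eq => /eqP ->.
rewrite addrC lerD2l mulrC ler_wpM2l ?(ltW a0)//; apply: Hb.
by rewrite !ltW.
Qed.

End LineSearch.

(** * A range of steps on which the Armijo condition holds *)

Section ArmijoRange.
Context {R : realType} {n m : nat}.
Variables (F : 'cV[R]_n -> 'cV[R]_m) (JF : 'cV[R]_n -> 'M[R]_(m, n)).
Variables (K : set 'cV[R]_m) (C : seq 'cV[R]_m) (e : 'cV[R]_m).
Variables (Lam : set 'cV[R]_n) (L M rho : R) (x0 : 'cV[R]_n).
Hypothesis dF : forall z, differentiable F z /\
  ('d F z : 'cV[R]_n -> 'cV[R]_m) = (fun u => JF z *m u).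
Hypothesis Kcl : closed K.
Hypothesis KP : forall y, K y <-> forall w, w \in C -> 0 <= dotv y w.
Hypothesis C0 : C != [::].
Hypothesis Ce : forall w, w \in C -> 0 <= dotv w e <= 1.
Hypothesis rho01 : 0 < rho < 1.
Hypothesis Lam_open : open Lam.
Hypothesis subLam : [set z | coneLe K (F z) (F x0)] `<=` Lam.
Hypothesis JF_lip : forall y z u, Lam y -> Lam z ->
  enorm ((JF y - JF z) *m u) <= L * enorm (y - z) * enorm u.
Hypothesis M0 : 0 <= M.
Hypothesis LM : forall w, w \in C -> L * enorm w <= M.

(* A trial point may leave the set where [JF] is Lipschitz; real induction shows
   that for such small [a] the whole segment stays in the level set of [x0]. *)
Lemma armijo_range x d a : coneLe K (F x) (F x0) -> hfun JF C x d < 0 ->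
  0 <= a -> a * M * enorm d ^+ 2 <= (1 - rho) * - hfun JF C x d ->
  coneLe K (F (x + a *: d)) (F x + (rho * a * hfun JF C x d) *: e).
Proof.
move=> xx0; set h := hfun JF C x d => h0 a0 aM.
have [r0 r1] := andP rho01.
have d0 : 0 <= enorm d ^+ 2 by rewrite exprn_ge0 ?enorm_ge0.
have armijo t : 0 <= t <= a -> (forall s, 0 <= s <= t -> Lam (x + s *: d)) ->
    coneLe K (F (x + t *: d)) (F x + (rho * t * h) *: e).
  move=> /andP[t0 ta] segL; apply/KP => w wC.
  have /andP[e0 e1] := Ce wC.
  have inc : dotv (F (x + t *: d)) w <=
      dotv (F x) w + t * (h + t * M * enorm d ^+ 2).
    apply: line_increment_le => // s /andP[s0 st].
    (* The first term contributes at most [h], the second at most [s * M * enorm d ^+ 2] by the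
       Lipschitz bound. *)
    have -> : JF (x + s *: d) = JF x + (JF (x + s *: d) - JF x).
      by rewrite [RHS]addrC subrK.
    rewrite mulmxDl dotvDl lerD ?dotv_le_hfun//.
    apply: le_trans (dotv_le_enorm _ _) _.
    have Lx : Lam x by have := segL 0; rewrite scale0r addr0; apply; rewrite lexx.
    have Ls : Lam (x + s *: d) by apply: segL; rewrite s0.
    have := JF_lip d Ls Lx; rewrite addrAC subrr add0r enormZ ger0_norm//.
    move=> /(ler_wpM2r (enorm_ge0 w)) /le_trans; apply.
    have -> : L * (s * enorm d) * enorm d * enorm w
            = L * enorm w * (s * enorm d ^+ 2) by ring.
    have -> : t * M * enorm d ^+ 2 = M * (t * enorm d ^+ 2) by ring.
    apply: le_trans (_ : M * (s * enorm d ^+ 2) <= _).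
      by rewrite ler_wpM2r ?LM// mulr_ge0.
    by rewrite ler_wpM2l// ler_wpM2r.
  rewrite dotvBl dotvDl dotvZl subr_ge0; apply: le_trans inc _.
  rewrite lerD2l (dotvC e).
  have tM : t * M * enorm d ^+ 2 <= (1 - rho) * - h.
    by apply: le_trans aM; rewrite ler_wpM2r// ler_wpM2r.
  apply: le_trans (_ : t * (rho * h) <= _); first by rewrite ler_wpM2l//; lra.
  (* As [h < 0], the bound [<w, e> <= 1] is what turns scalar decrease into decrease along [e]. *)
  rewrite -subr_ge0 (_ : _ - _ = rho * t * (- h) * (1 - dotv w e)); last by ring.
  by rewrite !mulr_ge0 ?subr_ge0 ?oppr_ge0 ?(ltW h0) ?(ltW r0).
(* The Armijo term is a nonpositive multiple of [e], so an Armijo point cannot leave the level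
   set. *)
have level t : 0 <= t <= a -> (forall s, 0 <= s <= t -> Lam (x + s *: d)) ->
    coneLe K (F (x + t *: d)) (F x0).
  move=> ta /(armijo _ ta) /KP At; apply/KP => w wC.
  have := At w wC; have /KP /(_ w wC) := xx0; have /andP[e0 _] := Ce wC.
  have /andP[t0 _] := ta.
  rewrite !(dotvBl, dotvDl, dotvZl) (dotvC e) => ? ?.
  have : 0 <= rho * t * (- h) * dotv w e.
    by rewrite !mulr_ge0 ?oppr_ge0 ?(ltW h0) ?(ltW r0).
  lra.
suff seg t : 0 <= t <= a -> coneLe K (F (x + t *: d)) (F x0).
  by apply: armijo => [|s sa]; [rewrite a0 lexx|apply: subLam; exact: seg].
apply: (real_induction (P := fun t => coneLe K (F (x + t *: d)) (F x0))).
- by rewrite scale0r addr0.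
- apply: (closed_comp (f := fun t : R => F x0 - F (x + t *: d)) (D := K)) => // s _.
  apply: (@continuousB R 'cV[R]_m R (cst (F x0)) (fun t => F (x + t *: d)) s).
    exact: cst_continuous.
  exact: (continuous_F_line dF).
- move=> s /andP[s0 sa] Ps.
  have : nbhs (x + s *: d) Lam.
    by apply: open_nbhs_nbhs; split => //; apply: subLam; apply: Ps; rewrite s0 lexx.
  move=> /(@continuous_line _ _ x d s) /nbhs_ballP[eps /= eps0 epsL].
  exists eps => // r /andP[sr rs] ra; apply: level; first by rewrite ra andbT; lra.
  move=> q /andP[q0 qr]; have [qs|sq] := leP q s.
    by apply: subLam; apply: Ps; rewrite q0.
  by apply: epsL; rewrite /ball /= distrC gtr0_norm; lra.
Qed.

End ArmijoRange.

(** * Bounds on [beta] and the contradiction argument *)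

Section Recurrence.
Context {R : realType}.

(** Here [a] stands for [h(x^{k-1}, v(x^k))] and [b] for [h(x^k, d^{k-1})]. If [a <= 0] the
    numerator vanishes; otherwise [a] cancels and the denominator is [mu] times the maximum of [|b|]
    and [N'^2]. *)
Lemma beta_bounds (mu b a N N' : R) (beta := N ^+ 2 * (`|a| + a) /
    Num.max (mu * `|b * a|) (mu * N' ^+ 2 * `|a|)) :
  0 < mu -> 0 < N' ->
  [/\ 0 <= beta, beta <= 2 / mu * N ^+ 2 / N' ^+ 2 & beta * b <= 2 / mu * N ^+ 2].
Proof.
move=> mu0 N'0; have N2 : 0 <= N ^+ 2 := sqr_ge0 N.
have N'2 : 0 < N' ^+ 2 by rewrite exprn_gt0.
have c0 : 0 <= 2 / mu * N ^+ 2 by rewrite mulr_ge0// divr_ge0// ltW.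
have [a0|a0] := leP a 0.
  have -> : beta = 0 by rewrite /beta ler0_norm// addNr mulr0 mul0r.
  by rewrite mul0r; split=> //; rewrite divr_ge0// ltW.
set D := Num.max `|b| (N' ^+ 2).
have D0 : 0 < D by rewrite lt_max N'2 orbT.
have betaE : beta = 2 / mu * N ^+ 2 / D.
  rewrite /beta gtr0_norm// normrM (gtr0_norm a0) (mulrA mu `|b|) -maxr_pMl ?(ltW a0)//.
  by rewrite -maxr_pMr ?(ltW mu0)// -/D; field; rewrite !gt_eqF.
split.
- by rewrite betaE divr_ge0// ltW.
- by rewrite betaE ler_wpM2l// lef_pV2// le_max lexx orbT.
- rewrite betaE -(mulrA (2 / mu * N ^+ 2)) ler_piMr// mulrC ler_pdivrMr// mul1r.
  by apply: le_trans (ler_norm _) _; rewrite le_max lexx.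
Qed.

Lemma liminf_of_recurrence (N D H phi : nat -> R) (c q eta b gam : R) :
  0 < c -> 0 <= q < 1 -> 0 < eta -> 0 < gam ->
  (forall k, 0 < N k) -> (forall k, 0 < D k) ->
  (forall k, c * N k ^+ 2 <= H k) ->
  (forall k, D k.+1 <= N k.+1 + q * N k.+1 ^+ 2 / N k ^+ 2 * D k) ->
  (forall k, phi k.+1 <= phi k - eta * (H k / D k) ^+ 2) ->
  (forall k, b <= phi k) ->
  forall k0, exists2 k, (k0 <= k)%N & N k < gam.
Proof.
move=> c0 /andP[q0 q1] eta0 gam0 N0 D0 HN DD phiD phib k0; apply: contrapT => nex.
have Nge k : (k0 <= k)%N -> gam <= N k.
  by move=> kk; rewrite leNgt; apply/negP => ?; apply: nex; exists k.
have N20 k : 0 < N k ^+ 2 by rewrite exprn_gt0.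
pose u k := D k / N k ^+ 2.
have u0 k : 0 < u k by rewrite divr_gt0.
(* The second summand is the fixed point of [u = gam^-1 + q * u]. *)
pose U := u k0 + (gam * (1 - q))^-1.
have gq0 : 0 < gam * (1 - q) by rewrite mulr_gt0// subr_gt0.
have U0 : 0 < U by rewrite addr_gt0 ?invr_gt0.
have uU p : u (k0 + p)%N <= U.
  elim: p => [|p IH]; first by rewrite addn0 lerDl invr_ge0 ltW.
  rewrite addnS; set k := (k0 + p)%N in IH *.
  have step : u k.+1 <= gam^-1 + q * u k.
    rewrite /u ler_pdivrMr//; apply: le_trans (DD k) _.
    rewrite mulrDl; apply: lerD; last by rewrite le_eqVlt; apply/orP; left; apply/eqP; ring.
    rewrite mulrC ler_pdivlMr// expr2 ler_wpM2l ?(ltW (N0 _))//.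
    by apply: Nge; rewrite -addnS leq_addr.
  apply: le_trans step _.
  have -> : gam^-1 = (1 - q) * (gam * (1 - q))^-1.
    by field; rewrite !gt_eqF// subr_gt0.
  have := ler_wpM2l q0 IH; rewrite /U; have := u0 k0; nra.
(* A uniform lower bound for the drops of [phi], because [H k / D k >= c / u k >= c / U]. *)
pose t := eta * (c / U) ^+ 2.
have t0 : 0 < t by rewrite mulr_gt0// exprn_gt0// divr_gt0.
have dec p : phi (k0 + p)%N <= phi k0 - p%:R * t.
  elim: p => [|p IH]; first by rewrite addn0 mul0r subr0.
  rewrite addnS; apply: le_trans (phiD _) _; set k := (k0 + p)%N in IH *.
  suff : t <= eta * (H k / D k) ^+ 2 by rewrite -natr1; lra.
  rewrite ler_wpM2l ?(ltW eta0)// ler_pXn2r ?nnegrE ?divr_ge0 ?(ltW U0) ?(ltW c0) ?(ltW (D0 k))//.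
    rewrite ler_pdivlMr// mulrAC ler_pdivrMr//.
    apply: le_trans (_ : c * (N k ^+ 2 * U) <= _).
      by rewrite ler_wpM2l ?(ltW c0)// mulrC -ler_pdivrMr// uU.
    by rewrite mulrA ler_wpM2r ?HN// ltW.
  by apply: le_trans (HN k); exact: mulr_ge0 (ltW c0) (ltW (N20 k)).
pose p := (Num.bound ((phi k0 - b) / t)).
have := archi_boundP (x := (phi k0 - b) / t).
have h : 0 <= (phi k0 - b) / t by rewrite divr_ge0 ?subr_ge0// ltW.
move=> /(_ h); rewrite ltr_pdivrMr// => lt.
have := dec p; have := phib (k0 + p)%N; rewrite /p; lra.
Qed.

(** Every tail has infimum 0, so the sequence of tail infima is constant. *)
Lemma limn_einf_eq0 (u : nat -> R) : (forall k, 0 <= u k) ->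
  (forall gam, 0 < gam -> forall k0, exists2 k, (k0 <= k)%N & u k < gam) ->
  limn_einf (fun k => (u k)%:E) = 0%E.
Proof.
move=> u0 usmall; rewrite limn_einf_lim.
rewrite (_ : einfs _ = cst 0%E) ?lim_cst//; apply/funext => k0 /=.
apply/le_anti/andP; split; last first.
  by apply: le_ereal_inf_tmp => _ [k _ <-]; rewrite lee_fin.
apply/lee_addgt0Pr => gam gam0; rewrite add0e.
have [k k0k ukg] := usmall _ gam0 k0.
by apply: ge_ereal_inf; exists (u k)%:E; [exists k|rewrite lee_fin ltW].
Qed.

End Recurrence.

(** Supplies a number of backtracking steps that does not depend on the iterate. *)
Lemma exists_expr_le (R : realType) (delta kappa : R) :
  0 < delta < 1 -> 0 < kappa -> exists j : nat, delta ^+ j <= kappa.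
Proof.
move=> /andP[delta0 delta1] kappa0.
have delta_cvg : (fun j : nat => delta ^+ j) @ \oo --> (0 : R).
  by apply: cvg_expr; rewrite gtr0_norm.
have /cvgr0_norm_le /(_ _ kappa0) [j _ jP] := delta_cvg.
have := jP j (leqnn j).
by rewrite /= ger0_norm ?exprn_ge0 ?(ltW delta0)// => ?; exists j.
Qed.

(** * Estimates along the iterates and conclusion *)

Theorem mainTheorem4 (R : realType) (n m : nat)
  (K : set 'cV[R]_m) (C : seq 'cV[R]_m)
  (F : 'cV[R]_n -> 'cV[R]_m) (JF : 'cV[R]_n -> 'M[R]_(m, n))
  (rho delta mu : R) (e : 'cV[R]_m)
  (x d : nat -> 'cV[R]_n) (alpha : nat -> R) :
  (* K : pointed, closed, convex cone, nonempty interior, finitely generated *)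
  is_cone K -> is_pointed K -> closed K -> is_convex K ->
  (exists z, (interior K) z) -> finitely_generated K ->
  (* C finite, 0 notin C, K^* = cone(conv(C)) *)
  (0 \notin C) -> polar K = cone_of (conv_hull C) ->
  (* F continuously differentiable with Jacobian JF *)
  (forall z, differentiable F z /\ ('d F z : 'cV[R]_n -> 'cV[R]_m) = (fun u => JF z *m u)) ->
  continuous JF ->
  (* parameters *)
  0 < rho < 1 -> 0 < delta < 1 -> 2 < mu ->
  (interior K) e -> (forall w, w \in C -> dotv w e <= 1) ->
  (* (A1) *)
  (exists (Lam : set 'cV[R]_n) (L : R), open Lam /\
     [set z | coneLe K (F z) (F (x 0%N))] `<=` Lam /\
     forall y z u, Lam y -> Lam z ->
       enorm ((JF y - JF z) *m u) <= L * enorm (y - z) * enorm u) ->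
  (* (A2) *)
  (forall D : nat -> 'cV[R]_m,
     (forall k, (F @` [set z | coneLe K (F z) (F (x 0%N))]) (D k)) ->
     (forall k, coneLe K (D k.+1) (D k)) ->
     exists D0, forall k, coneLe K D0 (D k)) ->
  (* the generated sequence *)
  d 0%N = vfun JF C (x 0%N) ->
  (forall k, (1 <= k)%N ->
     d k = vfun JF C (x k) +
       ((- hfun JF C (x k) (vfun JF C (x k))) *
          (`|hfun JF C (x k.-1) (vfun JF C (x k))|
             + hfun JF C (x k.-1) (vfun JF C (x k)))
        / Num.max (mu * `|hfun JF C (x k) (d k.-1) * hfun JF C (x k.-1) (vfun JF C (x k))|)
                  (- mu * hfun JF C (x k.-1) (vfun JF C (x k.-1))
                     * `|hfun JF C (x k.-1) (vfun JF C (x k))|)) *: d k.-1) ->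
  (forall k, x k.+1 = x k + alpha k *: d k) ->
  (forall k,
     let tau := - hfun JF C (x k) (d k) / enorm (d k) ^+ 2 in
     let armijo := fun a : R =>
       coneLe K (F (x k + a *: d k)) (F (x k) + (rho * a * hfun JF C (x k) (d k)) *: e) in
     (exists j : nat, alpha k = delta ^+ j * tau) /\ armijo (alpha k) /\
     (forall j : nat, armijo (delta ^+ j * tau) -> delta ^+ j * tau <= alpha k)) ->
  (* the sequence is infinite: v(x^k) <> 0 *)
  (forall k, vfun JF C (x k) != 0) ->
  limn_einf (fun k => (enorm (vfun JF C (x k)))%:E) = 0%E.
Proof.
move=> Kcone _ Kcl Kconv _ _ nC0 KC dF _ rho01 delta01 mu2 Ke Ce1
  [Lam [L [Lam_open [subLam JF_lip]]]] A2 d0E dE xE alphaP v_neq0.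
have KP := generated_polarP Kcone Kconv Kcl KC.
have C0 := polar_generators_neq0 KC.
(* The single component [<F, w0>] will serve as the decreasing quantity [phi]. *)
have [w0 w0C] : exists w, w \in C by case: (C) C0 => // w s _; exists w; rewrite inE eqxx.
have polarC w : w \in C -> polar K w by move=> wC y /KP /(_ w wC); rewrite dotvC.
have Ce0 w : w \in C -> 0 < dotv w e.
  move=> wC; apply: (interior_dotv_gt0 (polarC _ wC) _ Ke).
  by apply: contraNneq nC0 => <-.
have Ce w : w \in C -> 0 <= dotv w e <= 1 by move=> wC; rewrite ltW ?Ce0 ?Ce1.
have [rho0 rho1] := andP rho01; have [delta0 delta1] := andP delta01.
have mu0 : 0 < mu by apply: lt_trans mu2.
pose W := seqmax (@enorm R m) C.
have CW w : w \in C -> enorm w <= W.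
  by move=> wC; have /seqmax_leP := lexx W; exact.
have W0 : 0 <= W := le_trans (enorm_ge0 w0) (CW _ w0C).
(* The absolute value covers an [L] of unknown sign; adding 1 makes [M] positive, so one can divide
   by it. *)
pose M := `|L| * W + 1.
have M0 : 0 < M by rewrite ltr_wpDl// mulr_ge0.
have LM w : w \in C -> L * enorm w <= M.
  move=> wC; apply: le_trans (_ : `|L| * W <= _); last by rewrite lerDl.
  apply: le_trans (_ : `|L| * enorm w <= _); last by rewrite ler_wpM2l// CW.
  by rewrite ler_wpM2r ?enorm_ge0// ler_norm.
have kappa0 : 0 < (1 - rho) / M by rewrite divr_gt0// subr_gt0.
have [j jkappa] := exists_expr_le delta01 kappa0.
set omega := delta ^+ j in jkappa.
have omega0 : 0 < omega by rewrite exprn_gt0.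
pose v k := vfun JF C (x k); pose N k := enorm (v k).
pose H k := - hfun JF C (x k) (d k).
have N0 k : 0 < N k by rewrite enorm_gt0 ?v_neq0.
have hv k : hfun JF C (x k) (v k) = - N k ^+ 2 by apply: hfun_vfun.
pose q := 2 / mu.
have q0 : 0 <= q by rewrite divr_ge0// ltW.
have q1 : q < 1 by rewrite ltr_pdivrMr// mul1r.
(* Replacing [h(x, v(x))] by [- N ^+ 2] gives the coefficient the form treated in [beta_bounds]. *)
have dS k : exists beta, [/\ d k.+1 = v k.+1 + beta *: d k, 0 <= beta,
    beta <= q * N k.+1 ^+ 2 / N k ^+ 2 &
    beta * hfun JF C (x k.+1) (d k) <= q * N k.+1 ^+ 2].
  rewrite dE//= -!/(v _) !hv opprK mulrNN.
  by have [] := beta_bounds (hfun JF C (x k.+1) (d k))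
    (hfun JF C (x k) (v k.+1)) (N k.+1) mu0 (N0 k); eexists; split.
have HN k : (1 - q) * N k ^+ 2 <= H k.
  case: k => [|k].
    by rewrite /H d0E hv opprK ler_piMl ?sqr_ge0//; lra.
  have [beta [dk beta0 _ betah]] := dS k.
  rewrite /H dk lerNr; apply: le_trans (hfunD_le JF C0 _ _ _) _.
  rewrite hv; have := hfunZ_le JF C0 (x k.+1) (d k) beta0.
  by move=> h1; have := le_trans h1 betah; lra.
have H0 k : 0 < H k.
  by apply: lt_le_trans (HN k); rewrite mulr_gt0 ?subr_gt0 ?exprn_gt0.
(* A zero direction would give [h >= 0], against [H k > 0]. *)
have D0 k : 0 < enorm (d k).
  apply: enorm_gt0; apply: contraTneq (H0 k) => dk.
  rewrite -leNgt oppr_le0 dk; have := dotv_le_hfun JF C0 (x k) 0 w0C.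
  by rewrite mulmx0 dot0v.
have tau0 k : 0 < H k / enorm (d k) ^+ 2 by rewrite divr_gt0// exprn_gt0.
have alpha0 k : 0 < alpha k.
  by have [[i ->] _] := alphaP k; rewrite mulr_gt0 ?(tau0 k)// exprn_gt0.
have decr k w : w \in C -> dotv (F (x k.+1)) w <=
    dotv (F (x k)) w - rho * alpha k * H k * dotv w e.
  move=> wC; have [_ [/KP /(_ w wC)]] := alphaP k.
  by rewrite -xE dotvBl dotvDl dotvZl (dotvC e) /H; lra.
have Fdecr k : coneLe K (F (x k.+1)) (F (x k)).
  apply/KP => w wC; rewrite dotvBl subr_ge0; apply: le_trans (decr k w wC) _.
  by rewrite gerBl !mulr_ge0// ltW// ?Ce0.
have level k : coneLe K (F (x k)) (F (x 0%N)).
  elim: k => [|k IH]; first by rewrite /coneLe subrr; case: Kcone.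
  have := convex_coneD Kcone Kconv IH (Fdecr k).
  by rewrite /coneLe addrA subrK.
(* The choice [omega <= (1 - rho) / M] puts the trial step [omega * tau] in the range of
   [armijo_range]; maximality of [alpha k] does the rest. *)
have alpha_ge k : omega * (H k / enorm (d k) ^+ 2) <= alpha k.
  have [_ [_]] := alphaP k; apply.
  apply: (armijo_range (M := M) dF Kcl KP C0 Ce rho01 Lam_open subLam JF_lip) => //.
  - exact: ltW.
  - by rewrite -oppr_gt0; exact: H0.
  - by rewrite mulr_ge0 ?ltW ?tau0.
  rewrite -/(H k) -/omega (_ : _ * M * _ = omega * M * H k); last first.
    by field; rewrite gt_eqF.
  by rewrite ler_wpM2r ?(ltW (H0 k))// -ler_pdivlMr.
have [Dinf Dinf_le] := A2 (fun k => F (x k)) (fun k => ex_intro2 _ _ (x k) (level k) erefl) Fdecr.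
apply: limn_einf_eq0 => [k|gam gam0]; first exact: enorm_ge0.
apply: (@liminf_of_recurrence R N (fun k => enorm (d k)) H
  (fun k => dotv (F (x k)) w0) (1 - q) q (rho * omega * dotv w0 e) (dotv Dinf w0)) => //.
- by rewrite subr_gt0.
- by rewrite q0.
- by rewrite !mulr_gt0 ?Ce0.
- move=> k; have [beta [-> beta0 betaq _]] := dS k.
  apply: le_trans (ler_enormD _ _) _; rewrite lerD2l enormZ ger0_norm//.
  by rewrite ler_wpM2r ?enorm_ge0.
(* One factor [H k] comes from the Armijo decrease, the other from the lower bound on [alpha k]. *)
- move=> k; apply: le_trans (decr k _ w0C) _; rewrite lerD2l lerN2.
  have -> : rho * omega * dotv w0 e * (H k / enorm (d k)) ^+ 2 =
      rho * dotv w0 e * H k * (omega * (H k / enorm (d k) ^+ 2)).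
    by field; rewrite gt_eqF.
  have -> : rho * alpha k * H k * dotv w0 e = rho * dotv w0 e * H k * alpha k by ring.
  by rewrite ler_wpM2l ?alpha_ge// !mulr_ge0 ?ltW ?Ce0.
- by move=> k; have /KP /(_ w0 w0C) := Dinf_le k; rewrite dotvBl subr_ge0.
Qed.
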